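(* Let $A\subseteq\omega$ be an infinite c.e. set, $n\ge1$, and let $\theta^{(n)}$ be a quasi-Gödel numbering of $\mathcal S^{(n)}_A$. Then there is no function $p\in\mathcal R^{(1)}$ such that for all $i\in\omega$: if $\theta^{(n)}_i\in\mathrm{Anf}^{(n)}_A$, then $p(i)$ is the edge length of $\mathrm{dom}(\theta^{(n)}_i)$.
   Context: $\omega$ is the set of natural numbers; $\mathcal R^{(n)}$ is the set of total computable functions $\omega^n\to\omega$. $\langle\cdot,\cdot\rangle:\omega^2\to\omega$ is a computable bijection with $\langle x,y\rangle\ge x,y$, extended by $\langle x\rangle=x$, $\langle x_1,\dots,x_{n+1}\rangle=\langle x_1,\langle x_2,\dots,x_{n+1}\rangle\rangle$. The edge length of a set of the form $\{0,\dots,a-1\}^n$ is $a$; the empty set has edge length $0$. $\mathrm{Anf}^{(n)}_A$ is the set of partial functions from $\omega^n$ to $\omega$ whose domain is either empty or equal to $\{0,\dots,a-1\}^n$ for some $a\in A$, and $\mathcal S^{(n)}_A=\mathcal R^{(n)}\cup\mathrm{Anf}^{(n)}_A$. The extended graph of an $n$-ary partial function $q$ is $\{\langle\langle\vec y\rangle,0\rangle:\vec y\in\omega^n\}\cup\{\langle\langle\vec x\rangle,q(\vec x)+1\rangle:\vec x\in\mathrm{dom}(q)\}$. A numbering of a set $X$ is a surjection $\omega\to X$. A numbering $\theta$ of $\mathcal S^{(n)}_A$ is a quasi-Gödel numbering if: (QGN I) the extended graph of $(i,\vec x)\mapsto\theta_i(\vec x)$ is the range of a function in $\mathcal R^{(1)}$;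 and (QGN II) for every $k\in\mathcal R^{(2)}$ there is $v\in\mathcal R^{(1)}$ such that for all $i\in\omega$, $r\in\mathcal S^{(n)}_A$: if $\{k(i,t):t\in\omega\}$ is the extended graph of $r$, then $r=\theta_{v(i)}$. *)

(* Defs.v *)
From mathcomp Require Import all_boot.
From mathcomp Require Import boolp classical_sets functions cardinality.

Set Implicit Arguments.
Unset Strict Implicit.
Unset Printing Implicit Defensive.

Local Open Scope classical_set_scope.

(* Partial functions from omega^n to omega; [None] means undefined. *)
Definition pfun (n : nat) : Type := n.-tuple nat -> option nat.

Definition dom (n : nat) (q : pfun n) : set (n.-tuple nat) :=
  [set x | isSome (q x)].

(* The composition f(g_0(x), ..., g_(m-1)(x)) is strict: it is undefined as
   soon as one of the g_i(x) is, even if f ignores that argument. *)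
Definition comp_pfun (m n : nat) (f : pfun m) (g : 'I_m -> pfun n) : pfun n :=
  fun x => if [forall i, isSome (g i x)]
           then f [tuple odflt 0 (g i x) | i < m] else None.

Fixpoint primrec_at (n : nat) (f : pfun n) (g : pfun n.+2)
    (x : n.-tuple nat) (k : nat) : option nat :=
  if k is j.+1
  then obind (fun z => g [tuple of j :: z :: x]) (primrec_at f g x j)
  else f x.

Definition primrec (n : nat) (f : pfun n) (g : pfun n.+2) : pfun n.+1 :=
  fun y => primrec_at f g [tuple of behead y] (thead y).

(* g x is the least y with f(y, x) = 0, where moreover f(z, x) has to be
   defined for all z < y. *)
Definition is_mu (n : nat) (f : pfun n.+1) (g : pfun n) : Prop :=
  forall x y, g x = Some y <->
    f [tuple of y :: x] = Some 0 /\
    forall z, z < y -> exists w, f [tuple of z :: x] = Some w.+1.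

(* Kleene's class of partial recursive functions. *)
Inductive partial_computable : forall n : nat, pfun n -> Prop :=
| pc_zero n : partial_computable (fun _ : n.-tuple nat => Some 0)
| pc_succ : partial_computable (fun x : 1.-tuple nat => Some (thead x).+1)
| pc_proj n (i : 'I_n) :
    partial_computable (fun x : n.-tuple nat => Some (tnth x i))
| pc_comp m n (f : pfun m) (g : 'I_m -> pfun n) :
    partial_computable f -> (forall i, partial_computable (g i)) ->
    partial_computable (comp_pfun f g)
| pc_primrec n (f : pfun n) (g : pfun n.+2) :
    partial_computable f -> partial_computable g ->
    partial_computable (primrec f g)
| pc_mu n (f : pfun n.+1) (g : pfun n) :
    partial_computable f -> is_mu f g -> partial_computable g.

Definition pfun_of (n : nat) (f : n.-tuple nat -> nat) : pfun n :=
  fun x => Some (f x).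

(* The set R^(n) of total computable functions omega^n -> omega. *)
Definition computable (n : nat) : set (n.-tuple nat -> nat) :=
  [set f | partial_computable (pfun_of f)].
Arguments computable : clear implicits.

Definition computably_enumerable (A : set nat) : Prop :=
  exists2 q : pfun 1, partial_computable q & A = [set x | dom q [tuple x]].

Record is_pairing (pr : nat -> nat -> nat) : Prop := IsPairing {
  pairing_computable :
    computable 2 (fun x : 2.-tuple nat => pr (tnth x ord0) (tnth x ord_max));
  pairing_bij : bijective (fun xy : nat * nat => pr xy.1 xy.2);
  pairing_ge : forall x y, x <= pr x y /\ y <= pr x y }.

(* <x> = x and <x_1, ..., x_(n+1)> = <x_1, <x_2, ..., x_(n+1)>>; the value on
   the empty sequence is never used. *)
Fixpoint tcode (pr : nat -> nat -> nat) (s : seq nat) : nat :=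
  match s with
  | [::] => 0
  | [:: x] => x
  | x :: s' => pr x (tcode pr s')
  end.

(* {0, ..., a-1}^n *)
Definition cube (n a : nat) : set (n.-tuple nat) :=
  [set x | forall i, tnth x i < a].
Arguments cube : clear implicits.

(* For n >= 1 the cube of edge length 0 is the empty set, so that at most one
   a is an edge length of a given D. *)
Definition is_edge_length (n : nat) (D : set (n.-tuple nat)) (a : nat) : Prop :=
  D = cube n a \/ (D = set0 /\ a = 0).

Definition Anf (A : set nat) (n : nat) : set (pfun n) :=
  [set q | dom q = set0 \/ exists2 a, A a & dom q = cube n a].
Arguments Anf : clear implicits.

(* S_A^(n), the union of R^(n) and Anf_A^(n) *)
Definition calS (A : set nat) (n : nat) : set (pfun n) :=
  @pfun_of n @` computable n `|` Anf A n.
Arguments calS : clear implicits.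

Definition extended_graph (pr : nat -> nat -> nat) (n : nat) (q : pfun n) :
    set nat :=
  [set pr (tcode pr y) 0 | y in [set: n.-tuple nat]] `|`
  [set z | exists x y, q x = Some y /\ z = pr (tcode pr x) y.+1].

Definition is_numbering (T : Type) (X : set T) (theta : nat -> T) : Prop :=
  range theta = X.

(* The (n+1)-ary partial function (i, x) |-> theta_i(x). *)
Definition uncurry_numbering (n : nat) (theta : nat -> pfun n) : pfun n.+1 :=
  fun y => theta (thead y) [tuple of behead y].

Record quasi_goedel_numbering (pr : nat -> nat -> nat) (A : set nat) (n : nat)
    (theta : nat -> pfun n) : Prop := QuasiGoedelNumbering {
  qgn_numbering : is_numbering (calS A n) theta;
  qgn_I : exists2 h : 1.-tuple nat -> nat, computable 1 h &
    range h = extended_graph pr (uncurry_numbering theta);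
  qgn_II : forall k : 2.-tuple nat -> nat, computable 2 k ->
    exists2 v : 1.-tuple nat -> nat, computable 1 v &
      forall (i : nat) (r : pfun n), calS A n r ->
        range (fun t : nat => k [tuple i; t]) = extended_graph pr r ->
        r = theta (v [tuple i]) }.

(* Main.v *)
(* If theta_i(i, ..., i) = 0 let r_i be the zero function on the cube of edge
   length a, for a fixed positive a in A; otherwise let r_i be nowhere defined.
   The extended graph of r_i can be enumerated uniformly in i, so by (QGN II)
   r_i = theta_v(i) with v computable.  A computable edge length p would thus
   decide whether theta_i(i, ..., i) = 0, namely by p(v(i)) <> 0, and then the
   total function sending x to 0 if p(v(x_1)) = 0 and to 1 otherwise would
   differ from every theta_i at (i, ..., i). *)

Require Import Defs.
From mathcomp Require Import all_boot.
From mathcomp Require Import boolp classical_sets functions cardinality.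

Set Implicit Arguments.
Unset Strict Implicit.
Unset Printing Implicit Defensive.

Local Open Scope classical_set_scope.

(** * Closure properties of the total computable functions *)

Lemma computable_comp m n (f : m.-tuple nat -> nat)
    (g : 'I_m -> n.-tuple nat -> nat) :
  computable m f -> (forall i, computable n (g i)) ->
  computable n (fun x => f [tuple g i x | i < m]).
Proof.
move=> fc gc; rewrite /computable /=.
have -> : pfun_of (fun x => f [tuple g i x | i < m]) =
    comp_pfun (pfun_of f) (fun i => pfun_of (g i)).
  by apply/funext => x; rewrite /comp_pfun ifT //; apply/forallP.
exact: pc_comp.
Qed.

Lemma computable_proj n (i : 'I_n) : computable n (fun x => tnth x i).
Proof. exact: pc_proj. Qed.

Lemma computable_comp1 n (h : 1.-tuple nat -> nat) f :
  computable 1 h -> computable n f -> computable n (fun x => h [tuple f x]).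
Proof.
move=> hc fc; have := @computable_comp _ _ _ (fun=> f) hc (fun=> fc).
congr (computable n _); apply/funext => x; congr h.
by apply/eq_from_tnth => i; rewrite tnth_mktuple ord1.
Qed.

Lemma computable_comp2 n (F : nat -> nat -> nat) f g :
  computable 2 (fun x => F (tnth x ord0) (tnth x ord_max)) ->
  computable n f -> computable n g -> computable n (fun x => F (f x) (g x)).
Proof.
move=> Fc fc gc.
have := @computable_comp _ _ _ (fun i : 'I_2 => if i == ord0 then f else g) Fc.
move=> /(_ _)/wrap[]; first by move=> i; case: ifP.
by congr (computable n _); apply/funext => x; rewrite !tnth_mktuple.
Qed.

Lemma computable_succ n f : computable n f -> computable n (fun x => (f x).+1).
Proof. exact: (@computable_comp1 _ (fun y => (thead y).+1) _ pc_succ). Qed.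

Lemma computable_const n c : computable n (fun=> c).
Proof. by elim: c => [|c IHc]; [exact: pc_zero | exact: computable_succ]. Qed.

Lemma computable_behead n f :
  computable n f -> computable n.+1 (fun x => f [tuple of behead x]).
Proof.
move=> fc; have := @computable_comp _ _ _
  (fun (i : 'I_n) (x : n.+1.-tuple nat) => tnth x (lift ord0 i)) fc.
move=> /(_ _)/wrap[]; first by move=> i; exact: computable_proj.
congr (computable _ _); apply/funext => x; congr f.
by apply/eq_from_tnth => i; rewrite tnth_mktuple tnth_behead; congr tnth;
  apply/val_inj; rewrite /= inordK // ltnS.
Qed.

(** Primitive recursion with a computable bound: [pc_primrec] gives the recursion [R] with the
    counter as first argument, and composing [R] with [u x :: x] substitutes the bound. *)
Lemma computable_iteri n (u b : n.-tuple nat -> nat)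
    (s : nat -> nat -> n.-tuple nat -> nat) :
  computable n u -> computable n b ->
  computable n.+2 (fun y => s (thead y) (thead [tuple of behead y])
                              [tuple of behead [tuple of behead y]]) ->
  computable n (fun x => iteri (u x) (fun j z => s j z x) (b x)).
Proof.
move=> uc bc sc.
pose R (y : n.+1.-tuple nat) := let x := [tuple of behead y] in
  iteri (thead y) (fun j z => s j z x) (b x).
have Rc : computable n.+1 R.
  rewrite /computable /=; have := pc_primrec bc sc; congr partial_computable.
  apply/funext => y; rewrite /primrec /pfun_of /R /=.
  elim: (thead y) => //= j -> /=; congr (Some (s _ _ _)).
  exact/val_inj.
have := @computable_comp _ _ _ (fun (i : 'I_n.+1) (x : n.-tuple nat) =>
  tnth [tuple of u x :: x] i) Rc.
move=> /(_ _)/wrap[].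
  move=> i; case: (unliftP ord0 i) => [j|] ->.
    have -> : (fun x : n.-tuple nat => tnth [tuple of u x :: x] (lift ord0 j)) =
        fun x => tnth x j by apply/funext => x; rewrite tnthS.
    exact: computable_proj.
  exact: uc.
congr (computable _ _); apply/funext => x.
have -> : [tuple tnth [tuple of u x :: x] i | i < n.+1] = [tuple of u x :: x].
  by apply/eq_from_tnth => i; rewrite tnth_mktuple.
rewrite /R theadE; suff -> : [tuple of behead [tuple of u x :: x]] = x by [].
exact/val_inj.
Qed.

(** Iterating the constant step [g x] from the start value [f x] leaves [f x] after zero rounds and
    gives [g x] after any positive number of rounds. *)
Lemma computable_if0 n u f g :
  computable n u -> computable n f -> computable n g ->
  computable n (fun x => if u x == 0 then f x else g x).
Proof.
move=> uc fc gc.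
have := @computable_iteri _ u f (fun _ _ x => g x) uc fc.
move=> /(_ _)/wrap[]; first exact: (computable_behead (computable_behead gc)).
by congr (computable _ _); apply/funext => x; case: (u x).
Qed.

Lemma computable_pred n f : computable n f -> computable n (fun x => (f x).-1).
Proof.
(* The iteration returns its last counter, which is the bound minus one. *)
move=> fc; have := @computable_iteri _ f _ (fun j _ _ => j) fc
  (computable_const n 0) (computable_proj ord0).
by congr (computable _ _); apply/funext => x; case: (f x).
Qed.

Lemma computable_sub n f g :
  computable n f -> computable n g -> computable n (fun x => f x - g x).
Proof.
move=> fc gc; have := @computable_iteri _ g f (fun _ z _ => z.-1) gc fc.
move=> /(_ _)/wrap[].
  apply: computable_pred.
  exact: (computable_behead (computable_proj ord0)).
congr (computable _ _); apply/funext => x.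
by elim: (g x) => [|m IHm]; rewrite ?subn0 //= IHm subnS.
Qed.

Lemma computable_if_eq n u v f g :
  computable n u -> computable n v -> computable n f -> computable n g ->
  computable n (fun x => if u x == v x then f x else g x).
Proof.
move=> uc vc fc gc.
(* Two numbers are equal exactly if both truncated differences vanish. *)
have := computable_if0 (computable_sub uc vc)
  (computable_if0 (computable_sub vc uc) fc gc) gc.
congr (computable _ _); apply/funext => x.
by rewrite !subn_eq0 eqn_leq; case: (u x <= v x); case: (v x <= u x).
Qed.

(** Since [L] is fixed, the lookup is a finite case distinction on the index; the default value may
    depend on [x]. *)
Lemma computable_nth n (L : seq nat) e u :
  computable n e -> computable n u ->
  computable n (fun x => nth (e x) L (u x)).
Proof.
move=> ec; elim: L u => [|c L IHL] u uc.
  by under eq_fun do rewrite nth_nil.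
have := computable_if0 uc (computable_const n c) (IHL _ (computable_pred uc)).
by congr (computable _ _); apply/funext => x; case: (u x).
Qed.

(** * Splicing a finite list into an enumeration *)

(** If [t0] is the first hit, this is the truncated difference [t - t0]. The form as an iteration
    avoids a search for [t0], so it is total and computable even if there is no hit. *)
Definition steps_since (hit : pred nat) (t : nat) : nat :=
  iteri t (fun j z => if z == 0 then if hit j then 1 else 0 else z.+1) 0.

Lemma steps_since_never (hit : pred nat) t :
  (forall j, ~~ hit j) -> steps_since hit t = 0.
Proof. by move=> nhit; elim: t => //= t ->; rewrite (negPf (nhit t)). Qed.

Lemma steps_since_first (hit : pred nat) t0 t :
  hit t0 -> (forall j, hit j -> t0 <= j) -> steps_since hit t = t - t0.
Proof.
move=> hit0 min0; elim: t => [|t IHt] //=; rewrite -/(steps_since hit t) IHt.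
rewrite subn_eq0; case: ltngtP => [ltt|gtt|->]; last by rewrite hit0 subSnn.
- case: ifP => [/min0|_]; first by rewrite leqNgt ltt.
  by apply/esym/eqP; rewrite subn_eq0.
- by rewrite subSn // ltnW.
Qed.

(* Splicing L in once, right after the first hit, enumerates a union without
   having to decode t as a pair. *)
Definition interrupted (e : nat -> nat) (L : seq nat) (hit : pred nat)
    (t : nat) : nat :=
  let d := steps_since hit t in
  if d == 0 then e t else nth (e (t - size L)) L d.-1.

Lemma range_interrupted_never e L (hit : pred nat) :
  (forall j, ~~ hit j) -> range (interrupted e L hit) = range e.
Proof.
move=> nhit; congr image; apply/funext => t.
by rewrite /interrupted steps_since_never.
Qed.

(** Up to the first hit [t0] the values are those of [e]; the next [size L] values are the entries
    of [L]; then [e] resumes at [t0.+1], delayed by [size L], so that none of its values is lost. *)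
Lemma range_interrupted_hit e L (hit : pred nat) :
  (exists j, hit j) ->
  range (interrupted e L hit) = range e `|` [set z | z \in L].
Proof.
move=> hitex; have [t0 hit0 min0] := ex_minnP hitex.
have E t : interrupted e L hit t =
    if t <= t0 then e t else nth (e (t - size L)) L (t - t0).-1.
  by rewrite /interrupted (steps_since_first _ hit0 min0) subn_eq0.
apply/seteqP; split=> [_ [t _ <-]|z [[c _ <-]|/(nthP 0)[j jL <-]]].
- rewrite E; case: ifP => _; first by left; exists t.
  have [lt|ge] := ltnP (t - t0).-1 (size L); first by right; rewrite /= mem_nth.
  by left; rewrite nth_default //; exists (t - size L).
- have [le|gt] := leqP c t0; first by exists c => //; rewrite E le.
  exists (c + size L) => //; rewrite E leqNgt ltn_addr //= nth_default ?addnK //.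
  (* The inequality is strict because [t0 < c], so the index [(c + size L - t0).-1] still lies
     beyond the end of [L]. *)
  have lt_sz : size L < c + size L - t0 by rewrite ltn_subRL ltn_add2r.
  by rewrite -ltnS (ltn_predK lt_sz).
(* The two occurrences of [nth] have different defaults, which agree since [j] is a valid index. *)
- exists (t0 + j.+1) => //; rewrite E leqNgt -{1}[t0]addn0 ltn_add2l /=.
  by rewrite addKn; exact: set_nth_default.
Qed.

(** * Zero functions on cubes and codes of extended graphs *)

Definition cube_zero (n a : nat) : pfun n :=
  fun x => if [forall i, tnth x i < a] then Some 0 else None.
Arguments cube_zero : clear implicits.

Lemma dom_cube_zero n a : dom (cube_zero n a) = cube n a.
Proof.
by apply/seteqP; split=> x; rewrite /dom /cube /cube_zero /=; case: forallP.
Qed.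

Section Coding.
Variables (pr : nat -> nat -> nat) (hpr : is_pairing pr).

Lemma pairing_inj a b c d : pr a b = pr c d -> a = c /\ b = d.
Proof.
move=> eq_pr; suff [-> ->] : (a, b) = (c, d) by [].
exact: (bij_inj (pairing_bij hpr)).
Qed.

(** Equal sizes are assumed because [tcode] identifies lists of different lengths, such as
    [[:: pr a b]] and [[:: a; b]]. *)
Lemma tcode_inj s1 s2 :
  size s1 = size s2 -> tcode pr s1 = tcode pr s2 -> s1 = s2.
Proof.
elim: s1 s2 => [|x [|x' s1] IHs] [|y [|y' s2]] //=; first by move=> _ ->.
move=> [sz] /pairing_inj[-> eqt]; congr cons.
exact: (IHs (y' :: s2) (congr1 S sz) eqt).
Qed.

Lemma tcode_surj n c : exists x : n.+1.-tuple nat, tcode pr x = c.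
Proof.
elim: n c => [|n IHn] c; first by exists [tuple c].
have [unpr _ /(_ c)] := pairing_bij hpr.
case: (unpr c) => a b /= prab; have [x xb] := IHn b.
by exists [tuple of a :: x]; move: xb; case/tupleP: x => y x /= ->.
Qed.

Lemma computable_pairing n f g :
  computable n f -> computable n g -> computable n (fun x => pr (f x) (g x)).
Proof. exact/computable_comp2/(pairing_computable hpr). Qed.

Lemma computable_tcode_nseq m n f :
  computable n f -> computable n (fun x => tcode pr (nseq m (f x))).
Proof.
move=> fc; elim: m => [|[|m] IHm] //=; first exact: computable_const.
exact: computable_pairing IHm.
Qed.

(** The successor keeps this code apart from the elements with second component 0, and injectivity
    of the coding recovers [x] and [y]. So a value of [q] can be read off from an enumeration of its
    extended graph. *)
Lemma extended_graph_mem n (q : pfun n) (x : n.-tuple nat) y :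
  extended_graph pr q (pr (tcode pr x) y.+1) <-> q x = Some y.
Proof.
split=> [[[x' _ /pairing_inj[]//]|[x' [y' [qx' /pairing_inj[]]]]]|qx].
  by move=> /tcode_inj xx' [->]; rewrite (val_inj (xx' _)) ?size_tuple.
by right; exists x, y.
Qed.

(** The second component 1 encodes the value 0. Tuples over ['I_a] form a finite type, so the points
    of the cube can be listed. *)
Definition cube_codes (n a : nat) : seq nat :=
  [seq pr (tcode pr (map val x)) 1 | x : n.-tuple 'I_a].

Lemma extended_graph_undefined n :
  extended_graph pr (fun _ : n.+1.-tuple nat => None) = range (pr ^~ 0).
Proof.
apply/seteqP; split=> [z [[x _ <-]|[? [? []]]] //|z [c _ <-]].
by left; have [x <-] := tcode_surj n c; exists x.
Qed.

(** Compared with the nowhere defined function, only a fixed finite list is added; this is the list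
    that [interrupted] splices in. *)
Lemma extended_graph_cube_zero n a :
  extended_graph pr (cube_zero n.+1 a) =
  range (pr ^~ 0) `|` [set z | z \in cube_codes n.+1 a].
Proof.
rewrite -(extended_graph_undefined n); apply/seteqP; split=> z.
- case=> [?|[x [y [+ ->]]]]; first by left; left.
  rewrite /cube_zero; case: forallP => // xa [<-]; right.
  apply/fintype.imageP; exists [tuple Ordinal (xa i) | i < n.+1] => //.
  congr (pr (tcode pr _) 1); rewrite -[RHS]/(tval (map_tuple val _)).
  by congr tval; apply/eq_from_tnth => i; rewrite tnth_map tnth_mktuple.
- case=> [[?|[? [? []]]] //|/fintype.imageP[x _ ->]]; first by left.
  right; exists (map_tuple val x), 0; split=> //.
  by rewrite /cube_zero ifT //; apply/forallP => i; rewrite tnth_map /=.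
Qed.

(** This supplies the function [k] for (QGN II): the entries of [y] are the index [i] and the time
    [t], and a hit means that [h] lists the code sought for [i]. *)
Lemma computable_interrupted L (h : 1.-tuple nat -> nat)
    (c : 1.-tuple nat -> nat) :
  computable 1 h -> computable 1 c ->
  computable 2 (fun y => interrupted (pr ^~ 0) L
    (fun j => h [tuple j] == c [tuple tnth y ord0]) (tnth y ord_max)).
Proof.
move=> hc cc; have projc := computable_proj.
have dc : computable 2 (fun y => steps_since
    (fun j => h [tuple j] == c [tuple tnth y ord0]) (tnth y ord_max)).
  apply: (@computable_iteri _ _ _ (fun j z y => if z == 0 then
    if h [tuple j] == c [tuple tnth y ord0] then 1 else 0 else z.+1)) => //.
    exact: computable_const.
  (* The four arguments are the counter [j], the accumulator [z], and then [i] and [t]. *)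
  have zc : computable 4 (fun y => thead [tuple of behead y]).
    exact: (computable_behead (projc _ ord0)).
  apply: computable_if0 => //; last exact: computable_succ.
  apply: computable_if_eq; try exact: computable_const.
    exact: (computable_comp1 hc (projc _ ord0)).
  apply: (computable_comp1 cc).
  exact: (computable_behead (computable_behead (projc _ ord0))).
apply: computable_if0 => //.
  by apply: computable_pairing => //; exact: computable_const.
apply: computable_nth; last exact: computable_pred.
apply: computable_pairing; last exact: computable_const.
by apply: computable_sub => //; exact: computable_const.
Qed.

End Coding.

(** * Edge lengths and the diagonal argument *)

Lemma edge_length_set0 n a : is_edge_length (@set0 (n.+1.-tuple nat)) a -> a = 0.
Proof.
case=> [e0|[]//]; case: a e0 => // a e0.
(* The origin lies in every cube of positive edge length. *)
suff : @set0 (n.+1.-tuple nat) [tuple 0 | _ < n.+1] by [].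
by rewrite e0 => i; rewrite tnth_mktuple.
Qed.

Lemma edge_length_cube n a : 0 < a -> ~ is_edge_length (cube n.+1 a) 0.
Proof.
move=> a_gt0 cube0; suff : @set0 (n.+1.-tuple nat) [tuple 0 | _ < n.+1] by [].
have -> : set0 = cube n.+1 a.
  case: cube0 => [->|[-> //]].
  (* In positive dimension the cube of edge length 0 is empty, since no coordinate is below 0. *)
  by apply/seteqP; split=> // x /(_ ord0).
by move=> i; rewrite tnth_mktuple.
Qed.

Lemma infinite_set_pos (A : set nat) : infinite_set A -> exists2 a, A a & 0 < a.
Proof.
move=> A_inf; apply: contrapT => npos; apply: A_inf.
apply: (@sub_finite_set _ _ [set 0]); last exact: finite_set1.
by move=> [|a] Aa //; case: npos; exists a.+1.
Qed.

Theorem corollary4p18 (pr : nat -> nat -> nat) (hpr : is_pairing pr)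
    (A : set nat) (A_inf : infinite_set A) (A_ce : computably_enumerable A)
    (n : nat) (n_ge1 : 1 <= n) (theta : nat -> pfun n)
    (htheta : quasi_goedel_numbering pr A theta) :
  ~ exists2 p : 1.-tuple nat -> nat, computable 1 p &
      forall i : nat, Anf A n (theta i) ->
        is_edge_length (dom (theta i)) (p [tuple i]).
Proof.
case: n n_ge1 theta htheta => // n _ theta [num [h hc h_graph] qgn2] [p pc pP].
have [a Aa a_gt0] := infinite_set_pos A_inf.
pose diag (i : nat) := [tuple of nseq n.+1 i].
(* The element of the extended graph of the numbering saying that [theta i (diag i)] is 0: the index
   and the [n.+1] arguments make [n.+2] copies of [i], and 1 is the shifted value 0. *)
pose c (y : 1.-tuple nat) := pr (tcode pr (nseq n.+2 (tnth y ord0))) 1.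
have cc : computable 1 c.
  apply: (computable_pairing hpr); last exact: computable_const.
  by apply: (computable_tcode_nseq hpr); exact: computable_proj.
pose hit i j := h [tuple j] == c [tuple i].
have hitP i : (exists j, hit i j) <-> theta i (diag i) = Some 0.
  have -> : (theta i (diag i) = Some 0) =
      (uncurry_numbering theta [tuple of nseq n.+2 i] = Some 0).
    rewrite /uncurry_numbering; congr (theta _ _ = _).
    exact/val_inj.
  rewrite -(extended_graph_mem hpr) -h_graph; split=> [[j /eqP hj]|[y _ hy]].
    by exists [tuple j].
  by exists (thead y); apply/eqP; rewrite -[RHS]hy; case/tupleP: y {hy} => j y;
    rewrite theadE; congr h; rewrite (tuple0 y).
(* For each [i] the enumerated set is one of two extended graphs: that of [cube_zero n.+1 a] if
   there is a hit, and that of the nowhere defined function otherwise. In both cases [v] yields an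
   index of the function. *)
have [v vc vP] := qgn2 _
  (computable_interrupted hpr (cube_codes pr n.+1 a) hc cc).
have theta_pos i : theta i (diag i) = Some 0 -> p [tuple v [tuple i]] <> 0.
  move=> /hitP hiti pv0.
  have Anf_r : Anf A n.+1 (cube_zero n.+1 a).
    by right; exists a => //; exact: dom_cube_zero.
  have theta_v : cube_zero n.+1 a = theta (v [tuple i]).
    apply: vP; first by right.
    by rewrite (extended_graph_cube_zero hpr) -(range_interrupted_hit _ _ hiti).
  (* By [pv0] the function [p] would assign edge length 0 to a cube of positive edge length. *)
  apply: (@edge_length_cube n a a_gt0); rewrite -dom_cube_zero -pv0 theta_v.
  by apply: pP; rewrite -theta_v.
have theta_neq i : theta i (diag i) <> Some 0 -> p [tuple v [tuple i]] = 0.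
  move=> /hitP nhit.
  have dom0 : dom (fun _ : n.+1.-tuple nat => None) = set0.
    by apply/seteqP; split.
  have Anf_r : Anf A n.+1 (fun=> None) by left.
  have theta_v : (fun=> None) = theta (v [tuple i]).
    apply: vP; first by right.
    rewrite (extended_graph_undefined hpr).
    rewrite -(@range_interrupted_never (pr ^~ 0)
       (cube_codes pr n.+1 a) (hit i)) // => j.
    by apply/negP => hitj; apply: nhit; exists j.
  apply: (@edge_length_set0 n); rewrite -dom0 theta_v.
  by apply: pP; rewrite -theta_v.
pose g (x : n.+1.-tuple nat) :=
  if p [tuple v [tuple thead x]] == 0 then 0 else 1.
have gc : computable n.+1 g.
  apply: computable_if0; try exact: computable_const.
  do 2! apply: computable_comp1 => //.
  exact: computable_proj.
(* As a total computable function, [g] has an index [e]; its value at [diag e] contradicts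
   [theta_pos] or [theta_neq]. *)
have [e _ theta_e] : range theta (pfun_of g).
  by rewrite num; left; exists g.
have [pv0|pv_neq0] := eqVneq (p [tuple v [tuple e]]) 0.
  by apply: (theta_pos e) => //; rewrite theta_e /pfun_of /g pv0.
move/eqP: (pv_neq0); apply; apply: theta_neq.
by rewrite theta_e /pfun_of /g /= (negPf pv_neq0).
Qed.
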